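(* Let $\mathcal{C}$ be a regular category with pushouts along split monomorphisms. Then the following conditions are equivalent: (i) $\mathcal{C}$ is a Goursat category; (ii) for any regular epimorphism $\beta\colon Y\to W$ in $\mathcal{C}$ the functor $\beta_!\colon \mathrm{Pt}_Y(\mathcal{C})\to \mathrm{Pt}_W(\mathcal{C})$ preserves binary products; (iii) for any split epimorphisms with given splittings $f\colon X\to Y$ (splitting $i\colon Y\to X$) and $g\colon U\to W$ (splitting $j\colon W\to U$), and any regular epimorphisms $\alpha\colon X\to U$ and $\beta\colon Y\to W$ such that $g\alpha=\beta f$ and $\alpha i=j\beta$, the Beck-Chevalley condition holds: there is a (canonical) functor isomorphism $\alpha_!f^*\cong g^*\beta_!$ of functors $\mathrm{Pt}_Y(\mathcal{C})\to\mathrm{Pt}_U(\mathcal{C})$.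
   Context: A regular category $\mathcal{C}$ is called a Goursat category when $RSR=SRS$ for any two (effective) equivalence relations $R$ and $S$ on the same object of $\mathcal{C}$, where juxtaposition denotes the composition of relations and an equivalence relation is effective when it is the kernel pair of some morphism. A point over an object $Y$ of $\mathcal{C}$ is a triple $(X,f,i)$ where $f\colon X\to Y$ is a split epimorphism and $i\colon Y\to X$ is a fixed splitting, $fi=1_Y$. The category $\mathrm{Pt}_Y(\mathcal{C})$ has the points over $Y$ as objects; its morphisms $(X,f,i)\to(X',f',i')$ are the morphisms $x\colon X\to X'$ with $f'x=f$ and $xi=i'$. (It is the fibre over $Y$ of the fibration of points $\mathrm{Pt}(\mathcal{C})\to\mathcal{C}$ sending a point to its codomain.) Binary products in $\mathrm{Pt}_Y(\mathcal{C})$ are given by pullbacks over $Y$ in $\mathcal{C}$. For a morphism $\beta\colon Y\to W$, the change-of-base functor $\beta^*\colon\mathrm{Pt}_W(\mathcal{C})\to\mathrm{Pt}_Y(\mathcal{C})$ is defined by pulling back along $\beta$. When $\mathcal{C}$ has pushouts along split monomorphisms, $\beta^*$ has a left adjoint $\beta_!\colon\mathrm{Pt}_Y(\mathcal{C})\to\mathrm{Pt}_W(\mathcal{C})$, sending $(X,f,i)$ to $(\beta_!(X),\beta_!(f),\beta_!(i))$, where $\beta_!(X)$ is the pushout of $i\colon Y\to X$ and $\beta\colon Y\to W$, $\beta_!(i)\colon W\to\beta_!(X)$ is the induced pushout coprojection, and $\beta_!(f)\colon\beta_!(X)\to W$ is the morphism induced by $\beta f\colon X\to W$ and $1_W$.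 In the Beck-Chevalley condition, for a commutative square $g\alpha=\beta f$, the isomorphism is understood to be the canonical comparison natural transformation $$\alpha_!f^*\to\alpha_!f^*\beta^*\beta_!\cong\alpha_!\alpha^*g^*\beta_!\to g^*\beta_!$$ obtained from the unit of $\beta_!\dashv\beta^*$, the canonical isomorphism $f^*\beta^*\cong\alpha^*g^*$ and the counit of $\alpha_!\dashv\alpha^*$. *)

(* Defs.v *)
From Stdlib Require Import ssreflect ProofIrrelevance IndefiniteDescription.

Set Implicit Arguments.
Unset Strict Implicit.
Unset Printing Implicit Defensive.

(* The limits and colimits below are specified by [exists!]; [the] turns such a
   universal property into an actual mediating morphism. *)
Definition the (A : Type) (P : A -> Prop) (H : exists! x, P x) : A :=
  proj1_sig (constructive_indefinite_description (unique P) H).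

Lemma the_spec (A : Type) (P : A -> Prop) (H : exists! x, P x) : P (the H).
Proof. by rewrite /the; case: constructive_indefinite_description => x []. Qed.

Record Category := {
  Ob :> Type;
  Hom : Ob -> Ob -> Type;
  idm : forall X, Hom X X;
  comp : forall X Y Z, Hom Y Z -> Hom X Y -> Hom X Z;
  comp_idl : forall X Y (f : Hom X Y), comp (idm Y) f = f;
  comp_idr : forall X Y (f : Hom X Y), comp f (idm X) = f;
  comp_assoc : forall X Y Z T (h : Hom Z T) (g : Hom Y Z) (f : Hom X Y),
    comp h (comp g f) = comp (comp h g) f }.

Arguments Hom {c} X Y.
Arguments idm {c} X.
Arguments comp {c X Y Z} g f.
Notation "g ∘ f" := (comp g f) (at level 40, left associativity).

Definition IsIso (C : Category) (X Y : C) (f : Hom X Y) : Prop :=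
  exists g : Hom Y X, g ∘ f = idm X /\ f ∘ g = idm Y.

Record Functor (C D : Category) := {
  fob :> C -> D;
  fmap : forall X Y : C, Hom X Y -> Hom (fob X) (fob Y);
  fmap_id : forall X, fmap (idm X) = idm (fob X);
  fmap_comp : forall X Y Z (g : Hom Y Z) (f : Hom X Y),
    fmap (g ∘ f) = fmap g ∘ fmap f }.

Arguments fmap {C D} _ {X Y} _.

Lemma fmap_square (C D : Category) (F : Functor C D) (X Y Z T : C)
    (p : Hom Y T) (q : Hom X Y) (r : Hom Z T) (s : Hom X Z) :
  p ∘ q = r ∘ s -> fmap F p ∘ fmap F q = fmap F r ∘ fmap F s.
Proof. by rewrite -!fmap_comp => ->. Qed.

Definition idF (C : Category) : Functor C C :=
  {| fob := fun X : C => X;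
     fmap := fun X Y f => f;
     fmap_id := fun X => eq_refl;
     fmap_comp := fun X Y Z g f => eq_refl |}.

Definition compF (C D E : Category) (G : Functor D E) (F : Functor C D) : Functor C E.
Proof.
  refine {| fob := fun X => G (F X); fmap := fun X Y f => fmap G (fmap F f) |}.
  - by move=> X; rewrite !fmap_id.
  - by move=> X Y Z g f; rewrite !fmap_comp.
Defined.

Record NatTrans (C D : Category) (F G : Functor C D) := {
  app :> forall X : C, Hom (F X) (G X);
  app_nat : forall (X Y : C) (f : Hom X Y), app Y ∘ fmap F f = fmap G f ∘ app X }.

Definition IsNatIso (C D : Category) (F G : Functor C D) (t : NatTrans F G) : Prop :=
  forall X : C, IsIso (t X).

Record Adjunction (C D : Category) (F : Functor C D) (G : Functor D C) := {
  unit : NatTrans (idF C) (compF G F);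
  counit : NatTrans (compF F G) (idF D);
  triangle_l : forall X : C, counit (F X) ∘ fmap F (unit X) = idm (F X);
  triangle_r : forall A : D, fmap G (counit A) ∘ unit (G A) = idm (G A) }.

(* For a_! -| a^* and b_! -| b^*, a transformation s : f^* b^* -> a^* g^* induces
   a_! f^* -> a_! f^* b^* b_! -> a_! a^* g^* b_! -> g^* b_!. *)
Section Mate.
Variables (CX CY CU CW : Category).
Variables (aL : Functor CX CU) (aR : Functor CU CX) (bL : Functor CY CW) (bR : Functor CW CY).
Variables (adj_a : Adjunction aL aR) (adj_b : Adjunction bL bR).
Variables (fR : Functor CY CX) (gR : Functor CW CU).
Variable s : NatTrans (compF fR bR) (compF aR gR).

Definition mate_app (A : CY) : Hom (compF aL fR A) (compF gR bL A) :=
  counit adj_a (gR (bL A)) ∘ fmap aL (s (bL A)) ∘ fmap aL (fmap fR (unit adj_b A)).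

Lemma mate_nat (A B : CY) (h : Hom A B) :
  mate_app B ∘ fmap (compF aL fR) h = fmap (compF gR bL) h ∘ mate_app A.
Proof.
  have n1 := fmap_square aL (fmap_square fR (app_nat (unit adj_b) h)).
  have n2 := fmap_square aL (app_nat s (fmap bL h)).
  have n3 := app_nat (counit adj_a) (fmap gR (fmap bL h)).
  rewrite /mate_app -!comp_assoc /= [X in _ ∘ (_ ∘ X)]n1 /=.
  by rewrite (comp_assoc (fmap aL (s (bL B)))) n2 !comp_assoc n3.
Qed.

Definition mate : NatTrans (compF aL fR) (compF gR bL) :=
  {| app := mate_app; app_nat := mate_nat |}.
End Mate.

Section Universal.
Variable C : Category.
Implicit Types X Y Z T W P Q : C.

Definition IsMono X Y (m : Hom X Y) : Prop :=
  forall T (u v : Hom T X), m ∘ u = m ∘ v -> u = v.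

Definition IsSplitMono Y X (i : Hom Y X) : Prop := exists r : Hom X Y, r ∘ i = idm Y.

Definition IsTerminal Z : Prop := forall T, exists! t : Hom T Z, True.

Definition IsProduct X Y P (p1 : Hom P X) (p2 : Hom P Y) : Prop :=
  forall T (a : Hom T X) (b : Hom T Y),
    exists! h : Hom T P, p1 ∘ h = a /\ p2 ∘ h = b.

Definition IsPullback X Y Z (f : Hom X Z) (g : Hom Y Z)
    P (p1 : Hom P X) (p2 : Hom P Y) : Prop :=
  f ∘ p1 = g ∘ p2 /\
  forall T (a : Hom T X) (b : Hom T Y), f ∘ a = g ∘ b ->
    exists! h : Hom T P, p1 ∘ h = a /\ p2 ∘ h = b.

Definition IsPushout Z X Y (f : Hom Z X) (g : Hom Z Y)
    P (q1 : Hom X P) (q2 : Hom Y P) : Prop :=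
  q1 ∘ f = q2 ∘ g /\
  forall T (a : Hom X T) (b : Hom Y T), a ∘ f = b ∘ g ->
    exists! h : Hom P T, h ∘ q1 = a /\ h ∘ q2 = b.

Definition IsCoequalizer X Y (u v : Hom X Y) Q (q : Hom Y Q) : Prop :=
  q ∘ u = q ∘ v /\
  forall T (a : Hom Y T), a ∘ u = a ∘ v -> exists! h : Hom Q T, h ∘ q = a.

Definition IsRegularEpi X Y (f : Hom X Y) : Prop :=
  exists (Z : C) (u v : Hom Z X), IsCoequalizer u v f.

Definition IsKernelPair X Y (f : Hom X Y) R (r1 r2 : Hom R X) : Prop :=
  IsPullback f f r1 r2.

Record Product X Y := {
  prod_ob : C;
  prod_1 : Hom prod_ob X;
  prod_2 : Hom prod_ob Y;
  prodP : IsProduct prod_1 prod_2 }.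

Record Pullback X Y Z (f : Hom X Z) (g : Hom Y Z) := {
  pb_ob : C;
  pb_1 : Hom pb_ob X;
  pb_2 : Hom pb_ob Y;
  pbP : IsPullback f g pb_1 pb_2 }.

Record Pushout Z X Y (f : Hom Z X) (g : Hom Z Y) := {
  po_ob : C;
  po_1 : Hom X po_ob;
  po_2 : Hom Y po_ob;
  poP : IsPushout f g po_1 po_2 }.

Record Coequalizer X Y (u v : Hom X Y) := {
  coeq_ob : C;
  coeq_map : Hom Y coeq_ob;
  coeqP : IsCoequalizer u v coeq_map }.

Definition prod_pair X Y (P : Product X Y) T (a : Hom T X) (b : Hom T Y)
  : Hom T (prod_ob P) := the (prodP P a b).

Lemma prod_pair_1 X Y (P : Product X Y) T (a : Hom T X) (b : Hom T Y) :
  prod_1 P ∘ prod_pair P a b = a.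
Proof. exact: (proj1 (the_spec (prodP P a b))). Qed.

Lemma prod_pair_2 X Y (P : Product X Y) T (a : Hom T X) (b : Hom T Y) :
  prod_2 P ∘ prod_pair P a b = b.
Proof. exact: (proj2 (the_spec (prodP P a b))). Qed.

Section PullbackLift.
Variables (X Y Z : C) (f : Hom X Z) (g : Hom Y Z) (P : Pullback f g).

Lemma pb_comm : f ∘ pb_1 P = g ∘ pb_2 P.
Proof. by case: (pbP P). Qed.

Definition pb_lift T (a : Hom T X) (b : Hom T Y) (e : f ∘ a = g ∘ b)
  : Hom T (pb_ob P) := the (proj2 (pbP P) T a b e).

Lemma pb_lift_1 T (a : Hom T X) (b : Hom T Y) (e : f ∘ a = g ∘ b) :
  pb_1 P ∘ pb_lift e = a.
Proof. exact: (proj1 (the_spec (proj2 (pbP P) T a b e))). Qed.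

Lemma pb_lift_2 T (a : Hom T X) (b : Hom T Y) (e : f ∘ a = g ∘ b) :
  pb_2 P ∘ pb_lift e = b.
Proof. exact: (proj2 (the_spec (proj2 (pbP P) T a b e))). Qed.

Lemma pb_ext T (h k : Hom T (pb_ob P)) :
  pb_1 P ∘ h = pb_1 P ∘ k -> pb_2 P ∘ h = pb_2 P ∘ k -> h = k.
Proof.
  move=> e1 e2.
  have e : f ∘ (pb_1 P ∘ k) = g ∘ (pb_2 P ∘ k) by rewrite !comp_assoc pb_comm.
  case: (proj2 (pbP P) T _ _ e) => x [_ U].
  by rewrite -(U h (conj e1 e2)) -(U k (conj eq_refl eq_refl)).
Qed.
End PullbackLift.

Section PushoutDesc.
Variables (Z X Y : C) (f : Hom Z X) (g : Hom Z Y) (P : Pushout f g).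

Lemma po_comm : po_1 P ∘ f = po_2 P ∘ g.
Proof. by case: (poP P). Qed.

Definition po_desc T (a : Hom X T) (b : Hom Y T) (e : a ∘ f = b ∘ g)
  : Hom (po_ob P) T := the (proj2 (poP P) T a b e).

Lemma po_desc_1 T (a : Hom X T) (b : Hom Y T) (e : a ∘ f = b ∘ g) :
  po_desc e ∘ po_1 P = a.
Proof. exact: (proj1 (the_spec (proj2 (poP P) T a b e))). Qed.

Lemma po_desc_2 T (a : Hom X T) (b : Hom Y T) (e : a ∘ f = b ∘ g) :
  po_desc e ∘ po_2 P = b.
Proof. exact: (proj2 (the_spec (proj2 (poP P) T a b e))). Qed.

Lemma po_ext T (h k : Hom (po_ob P) T) :
  h ∘ po_1 P = k ∘ po_1 P -> h ∘ po_2 P = k ∘ po_2 P -> h = k.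
Proof.
  move=> e1 e2.
  have e : (k ∘ po_1 P) ∘ f = (k ∘ po_2 P) ∘ g by rewrite -!comp_assoc po_comm.
  case: (proj2 (poP P) T _ _ e) => x [_ U].
  by rewrite -(U h (conj e1 e2)) -(U k (conj eq_refl eq_refl)).
Qed.
End PushoutDesc.

Definition coeq_desc X Y (u v : Hom X Y) (Q : Coequalizer u v)
    T (a : Hom Y T) (e : a ∘ u = a ∘ v) : Hom (coeq_ob Q) T :=
  the (proj2 (coeqP Q) T a e).

Lemma coeq_desc_map X Y (u v : Hom X Y) (Q : Coequalizer u v)
    T (a : Hom Y T) (e : a ∘ u = a ∘ v) : coeq_desc Q e ∘ coeq_map Q = a.
Proof. exact: (the_spec (proj2 (coeqP Q) T a e)). Qed.

Lemma regular_epi_epi X Y (q : Hom X Y) : IsRegularEpi q ->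
  forall T (a b : Hom Y T), a ∘ q = b ∘ q -> a = b.
Proof.
  move=> [Z [u [v [e U]]]] T a b eab.
  have E : (b ∘ q) ∘ u = (b ∘ q) ∘ v by rewrite -!comp_assoc e.
  case: (U T _ E) => x [_ Ux].
  by rewrite -(Ux a eab) -(Ux b eq_refl).
Qed.

End Universal.

Arguments prod_ob {C X Y} p.
Arguments pb_ob {C X Y Z f g} p.
Arguments pb_1 {C X Y Z f g} p.
Arguments pb_2 {C X Y Z f g} p.
Arguments po_ob {C Z X Y f g} p.
Arguments po_1 {C Z X Y f g} p.
Arguments po_2 {C Z X Y f g} p.

Definition PreservesBinaryProducts (C D : Category) (F : Functor C D) : Prop :=
  forall (X Y P : C) (p1 : Hom P X) (p2 : Hom P Y),
    IsProduct p1 p2 -> IsProduct (fmap F p1) (fmap F p2).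

(* (Co)limits are carried as chosen data; a theorem quantified over these
   records holds for every choice. *)
Record FinitelyComplete (C : Category) := {
  terminal : C;
  terminalP : IsTerminal terminal;
  product : forall X Y : C, Product X Y;
  pullback : forall (X Y Z : C) (f : Hom X Z) (g : Hom Y Z), Pullback f g }.

Arguments product {C} _ X Y.
Arguments pullback {C} _ {X Y Z} f g.

Record Regular (C : Category) := {
  regular_limits :> FinitelyComplete C;
  kernel_pair_coeq : forall (X Y : C) (f : Hom X Y),
    Coequalizer (pb_1 (pullback regular_limits f f)) (pb_2 (pullback regular_limits f f));
  regular_epi_stable : forall (X Y Z : C) (f : Hom X Z) (g : Hom Y Z)
      (P : C) (p1 : Hom P X) (p2 : Hom P Y),
    IsPullback f g p1 p2 -> IsRegularEpi f -> IsRegularEpi p2 }.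

Arguments kernel_pair_coeq {C} _ {X Y} f.

Definition PushoutsAlongSplitMonos (C : Category) : Type :=
  forall (Y X W : C) (i : Hom Y X) (b : Hom Y W), IsSplitMono i -> Pushout i b.

Section Images.
Variables (C : Category) (R : Regular C) (X Y : C) (f : Hom X Y).

Definition image_ob : C := coeq_ob (kernel_pair_coeq R f).
Definition image_epi : Hom X image_ob := coeq_map (kernel_pair_coeq R f).
Definition image_mono : Hom image_ob Y :=
  coeq_desc (kernel_pair_coeq R f) (pb_comm (pullback R f f)).

Lemma image_fact : image_mono ∘ image_epi = f.
Proof. exact: coeq_desc_map. Qed.

Lemma image_epi_regular : IsRegularEpi image_epi.
Proof. by do 3 eexists; exact: (coeqP (kernel_pair_coeq R f)). Qed.

Lemma image_monoP : IsMono image_mono.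
Proof.
  move=> T u v euv.
  pose P1 := pullback R image_epi u.
  pose P2 := pullback R image_epi (v ∘ pb_2 P1).
  have epi1 := regular_epi_epi (regular_epi_stable R (pbP P1) image_epi_regular).
  have epi2 := regular_epi_epi (regular_epi_stable R (pbP P2) image_epi_regular).
  have c1 : image_epi ∘ pb_1 P1 = u ∘ pb_2 P1 := pb_comm P1.
  have c2 : image_epi ∘ pb_1 P2 = (v ∘ pb_2 P1) ∘ pb_2 P2 := pb_comm P2.
  have ef : f ∘ (pb_1 P1 ∘ pb_2 P2) = f ∘ pb_1 P2.
    by rewrite -{1 2}image_fact -!comp_assoc c2 (comp_assoc image_epi) c1 !comp_assoc euv.
  have ek : image_epi ∘ (pb_1 P1 ∘ pb_2 P2) = image_epi ∘ pb_1 P2.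
    have [w [<- <-]] : exists w, pb_1 (pullback R f f) ∘ w = pb_1 P1 ∘ pb_2 P2 /\
        pb_2 (pullback R f f) ∘ w = pb_1 P2.
      by exists (pb_lift _ ef); split; [exact: pb_lift_1 | exact: pb_lift_2].
    by rewrite !comp_assoc (proj1 (coeqP (kernel_pair_coeq R f))).
  apply: epi1; apply: epi2.
  by rewrite -c2 -ek !comp_assoc c1.
Qed.
End Images.

Section Relations.
Variables (C : Category) (R : Regular C).

Record Relation (X Y : C) := {
  rel_ob : C;
  rel_map : Hom rel_ob (prod_ob (product R X Y));
  rel_mono : IsMono rel_map }.

Definition rel_1 X Y (S : Relation X Y) : Hom (rel_ob S) X :=
  prod_1 (product R X Y) ∘ rel_map S.
Definition rel_2 X Y (S : Relation X Y) : Hom (rel_ob S) Y :=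
  prod_2 (product R X Y) ∘ rel_map S.

Definition rel_le X Y (S T : Relation X Y) : Prop :=
  exists u : Hom (rel_ob S) (rel_ob T), rel_map T ∘ u = rel_map S.
(* Equality as subobjects of X * Y. *)
Definition rel_eq X Y (S T : Relation X Y) : Prop := rel_le S T /\ rel_le T S.

(* [rel_comp S T] relates x to z when x S y and y T z for some y. *)
Definition rel_comp X Y Z (S : Relation X Y) (T : Relation Y Z) : Relation X Z :=
  let P := pullback R (rel_2 S) (rel_1 T) in
  let h := prod_pair (product R X Z) (rel_1 S ∘ pb_1 P) (rel_2 T ∘ pb_2 P) in
  {| rel_ob := image_ob R h; rel_map := image_mono R h; rel_mono := @image_monoP C R _ _ h |}.

Definition IsEquivalence X (S : Relation X X) : Prop :=
  (exists d : Hom X (rel_ob S), rel_1 S ∘ d = idm X /\ rel_2 S ∘ d = idm X) /\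
  (exists s : Hom (rel_ob S) (rel_ob S), rel_1 S ∘ s = rel_2 S /\ rel_2 S ∘ s = rel_1 S) /\
  (let P := pullback R (rel_2 S) (rel_1 S) in
   exists t : Hom (pb_ob P) (rel_ob S),
     rel_1 S ∘ t = rel_1 S ∘ pb_1 P /\ rel_2 S ∘ t = rel_2 S ∘ pb_2 P).

Definition IsEffectiveEquivalence X (S : Relation X X) : Prop :=
  IsEquivalence S /\
  exists (Y : C) (f : Hom X Y), IsKernelPair f (rel_1 S) (rel_2 S).

Definition IsGoursat : Prop :=
  forall (X : C) (S T : Relation X X),
    IsEffectiveEquivalence S -> IsEffectiveEquivalence T ->
    rel_eq (rel_comp (rel_comp S T) S) (rel_comp (rel_comp T S) T).

End Relations.

Section PointCategory.
Variable C : Category.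

Record Point (Y : C) := {
  pt_ob : C;
  pt_epi : Hom pt_ob Y;
  pt_sec : Hom Y pt_ob;
  pt_split : pt_epi ∘ pt_sec = idm Y }.

Record PointHom (Y : C) (A B : Point Y) := {
  pt_map : Hom (pt_ob A) (pt_ob B);
  pt_map_epi : pt_epi B ∘ pt_map = pt_epi A;
  pt_map_sec : pt_map ∘ pt_sec A = pt_sec B }.

Lemma pt_hom_eq (Y : C) (A B : Point Y) (h k : PointHom A B) :
  pt_map h = pt_map k -> h = k.
Proof.
  case: h => h h1 h2; case: k => k k1 k2 /= e; subst k.
  by rewrite (proof_irrelevance _ h1 k1) (proof_irrelevance _ h2 k2).
Qed.

Definition pt_id (Y : C) (A : Point Y) : PointHom A A :=
  {| pt_map := idm (pt_ob A);
     pt_map_epi := comp_idr (pt_epi A);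
     pt_map_sec := comp_idl (pt_sec A) |}.

Definition pt_comp (Y : C) (A B D : Point Y) (k : PointHom B D) (h : PointHom A B)
  : PointHom A D.
Proof.
  refine {| pt_map := pt_map k ∘ pt_map h |}.
  - by rewrite comp_assoc !pt_map_epi.
  - by rewrite -comp_assoc !pt_map_sec.
Defined.

Definition Pt (Y : C) : Category.
Proof.
  refine {| Ob := Point Y; Hom := @PointHom Y; idm := @pt_id Y; comp := @pt_comp Y |}.
  - by move=> A B h; apply: pt_hom_eq; exact: comp_idl.
  - by move=> A B h; apply: pt_hom_eq; exact: comp_idr.
  - by move=> A B D E l k h; apply: pt_hom_eq; exact: comp_assoc.
Defined.

End PointCategory.

Section ChangeOfBase.
Variables (C : Category) (L : FinitelyComplete C) (Po : PushoutsAlongSplitMonos C).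

Section Pull.
Variables (Y W : C) (b : Hom Y W).

Definition pull_pb (A : Point W) : Pullback b (pt_epi A) := pullback L b (pt_epi A).

Lemma pull_sec_eq (A : Point W) : b ∘ idm Y = pt_epi A ∘ (pt_sec A ∘ b).
Proof. by rewrite comp_assoc pt_split comp_idl comp_idr. Qed.

Definition pull_ob (A : Point W) : Point Y :=
  {| pt_ob := pb_ob (pull_pb A);
     pt_epi := pb_1 (pull_pb A);
     pt_sec := pb_lift (pull_pb A) (pull_sec_eq A);
     pt_split := pb_lift_1 (pull_pb A) (pull_sec_eq A) |}.

Lemma pull_map_eq (A B : Point W) (h : PointHom A B) :
  b ∘ pb_1 (pull_pb A) = pt_epi B ∘ (pt_map h ∘ pb_2 (pull_pb A)).
Proof. by rewrite comp_assoc pt_map_epi; exact: pb_comm. Qed.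

Definition pull_map (A B : Point W) (h : PointHom A B) : PointHom (pull_ob A) (pull_ob B).
Proof.
  refine {| pt_map := pb_lift (pull_pb B) (pull_map_eq h) : Hom (pt_ob (pull_ob A)) (pt_ob (pull_ob B)) |} => /=.
  - exact: pb_lift_1.
  - apply: (pb_ext (P := pull_pb B)); rewrite comp_assoc ?pb_lift_1 ?pb_lift_2 //.
    by rewrite -comp_assoc pb_lift_2 comp_assoc pt_map_sec.
Defined.

(* b^*, pulling back along b. *)
Definition pull : Functor (Pt W) (Pt Y).
Proof.
  refine {| fob := pull_ob : Pt W -> Pt Y; fmap := pull_map |}.
  - move=> A; apply: pt_hom_eq; apply: (pb_ext (P := pull_pb A)) => /=;
      rewrite ?pb_lift_1 ?pb_lift_2 ?comp_idr ?comp_idl //.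
  - move=> A B D k h; apply: pt_hom_eq; apply: (pb_ext (P := pull_pb D)) => /=.
    + by rewrite comp_assoc !pb_lift_1.
    + by rewrite comp_assoc !pb_lift_2 -!comp_assoc pb_lift_2.
Defined.

Definition push_po (A : Point Y) : Pushout (pt_sec A) b :=
  Po b (ex_intro _ (pt_epi A) (pt_split A)).

Lemma push_epi_eq (A : Point Y) : (b ∘ pt_epi A) ∘ pt_sec A = idm W ∘ b.
Proof. by rewrite -comp_assoc pt_split comp_idl comp_idr. Qed.

Definition push_ob (A : Point Y) : Point W :=
  {| pt_ob := po_ob (push_po A);
     pt_epi := po_desc (push_po A) (push_epi_eq A);
     pt_sec := po_2 (push_po A);
     pt_split := po_desc_2 (push_po A) (push_epi_eq A) |}.

Lemma push_map_eq (A B : Point Y) (h : PointHom A B) :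
  (po_1 (push_po B) ∘ pt_map h) ∘ pt_sec A = po_2 (push_po B) ∘ b.
Proof. by rewrite -comp_assoc pt_map_sec; exact: po_comm. Qed.

Definition push_map (A B : Point Y) (h : PointHom A B) : PointHom (push_ob A) (push_ob B).
Proof.
  refine {| pt_map := po_desc (push_po A) (push_map_eq h) : Hom (pt_ob (push_ob A)) (pt_ob (push_ob B)) |} => /=.
  - apply: (po_ext (P := push_po A)); rewrite -comp_assoc ?po_desc_1 ?po_desc_2 //.
    by rewrite comp_assoc po_desc_1 -comp_assoc pt_map_epi.
  - exact: po_desc_2.
Defined.

(* b_!, left adjoint to b^* by [push_pull_adj]. *)
Definition push : Functor (Pt Y) (Pt W).
Proof.
  refine {| fob := push_ob : Pt Y -> Pt W; fmap := push_map |}.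
  - move=> A; apply: pt_hom_eq; apply: (po_ext (P := push_po A)) => /=;
      rewrite ?po_desc_1 ?po_desc_2 ?comp_idr ?comp_idl //.
  - move=> A B D k h; apply: pt_hom_eq; apply: (po_ext (P := push_po A)) => /=.
    + by rewrite -comp_assoc !po_desc_1 !comp_assoc po_desc_1.
    + by rewrite -comp_assoc !po_desc_2.
Defined.

Lemma push_unit_eq (A : Point Y) :
  b ∘ pt_epi A = pt_epi (push_ob A) ∘ po_1 (push_po A).
Proof. by rewrite /= po_desc_1. Qed.

Definition push_unit_app (A : Point Y) : PointHom A (pull_ob (push_ob A)).
Proof.
  refine {| pt_map := pb_lift (pull_pb (push_ob A)) (push_unit_eq A)
                      : Hom (pt_ob A) (pt_ob (pull_ob (push_ob A))) |} => /=.
  - exact: pb_lift_1.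
  - apply: (pb_ext (P := pull_pb (push_ob A))); rewrite comp_assoc.
    + by rewrite !pb_lift_1 pt_split.
    + by rewrite !pb_lift_2; exact: po_comm.
Defined.

Lemma push_counit_eq (A : Point W) :
  pb_2 (pull_pb A) ∘ pt_sec (pull_ob A) = pt_sec A ∘ b.
Proof. exact: pb_lift_2. Qed.

Definition push_counit_app (A : Point W) : PointHom (push_ob (pull_ob A)) A.
Proof.
  refine {| pt_map := po_desc (push_po (pull_ob A)) (push_counit_eq A)
                      : Hom (pt_ob (push_ob (pull_ob A))) (pt_ob A) |} => /=.
  - apply: (po_ext (P := push_po (pull_ob A))); rewrite -comp_assoc.
    + by rewrite !po_desc_1 -pb_comm.
    + by rewrite !po_desc_2 pt_split.
  - exact: po_desc_2.
Defined.

Definition push_unit : NatTrans (idF (Pt Y)) (compF pull push).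
Proof.
  refine {| app := push_unit_app : forall A : Pt Y, Hom (idF (Pt Y) A) (compF pull push A) |}.
  move=> A B h; apply: pt_hom_eq; apply: (pb_ext (P := pull_pb (push_ob B))) => /=;
    rewrite !comp_assoc ?pb_lift_1 ?pb_lift_2 ?pt_map_epi //.
  by rewrite -comp_assoc pb_lift_2 po_desc_1.
Defined.

Definition push_counit : NatTrans (compF push pull) (idF (Pt W)).
Proof.
  refine {| app := push_counit_app : forall A : Pt W, Hom (compF push pull A) (idF (Pt W) A) |}.
  move=> A B h; apply: pt_hom_eq; apply: (po_ext (P := push_po (pull_ob A))) => /=;
    rewrite -!comp_assoc ?po_desc_1 ?po_desc_2 ?pt_map_sec //.
  by rewrite comp_assoc po_desc_1 pb_lift_2.
Defined.

Definition push_pull_adj : Adjunction push pull.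
Proof.
  refine {| unit := push_unit; counit := push_counit |}.
  - move=> A; apply: pt_hom_eq; apply: (po_ext (P := push_po A)) => /=;
      rewrite -!comp_assoc ?po_desc_1 ?po_desc_2 ?comp_idl //.
    by rewrite comp_assoc po_desc_1 pb_lift_2.
  - move=> A; apply: pt_hom_eq; apply: (pb_ext (P := pull_pb A)) => /=;
      rewrite !comp_assoc ?pb_lift_1 ?pb_lift_2 ?comp_idr //.
    by rewrite -comp_assoc pb_lift_2 po_desc_1.
Defined.
End Pull.

Section BeckChevalley.
Variables (X Y U W : C) (f : Hom X Y) (g : Hom U W) (a : Hom X U) (b : Hom Y W).
Hypothesis e : g ∘ a = b ∘ f.

(* Towards the component X *_Y (Y *_W A) -> X *_U (U *_W A) of the
   canonical isomorphism f^* b^* -> a^* g^*. *)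
Lemma pull_square_eq1 (A : Point W) :
  let P := pull_pb f (pull_ob b A) in
  g ∘ (a ∘ pb_1 P) = pt_epi A ∘ (pb_2 (pull_pb b A) ∘ pb_2 P).
Proof.
  move=> P; rewrite comp_assoc e -comp_assoc.
  have -> : f ∘ pb_1 P = pb_1 (pull_pb b A) ∘ pb_2 P := pb_comm P.
  by rewrite !comp_assoc (pb_comm (pull_pb b A)).
Qed.

Lemma pull_square_eq2 (A : Point W) :
  let P := pull_pb f (pull_ob b A) in
  a ∘ pb_1 P = pt_epi (pull_ob g A) ∘ pb_lift (pull_pb g A) (pull_square_eq1 A).
Proof. by move=> P; rewrite /= pb_lift_1. Qed.

Definition pull_square_app (A : Point W)
  : PointHom (pull_ob f (pull_ob b A)) (pull_ob a (pull_ob g A)).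
Proof.
  refine {| pt_map := pb_lift (pull_pb a (pull_ob g A)) (pull_square_eq2 A)
     : Hom (pt_ob (pull_ob f (pull_ob b A))) (pt_ob (pull_ob a (pull_ob g A))) |} => /=.
  - exact: pb_lift_1.
  - apply: (pb_ext (P := pull_pb a (pull_ob g A))); rewrite comp_assoc.
    + by rewrite !pb_lift_1.
    + rewrite !pb_lift_2 /=.
      apply: (pb_ext (P := pull_pb g A)); rewrite !comp_assoc ?pb_lift_1 ?pb_lift_2.
      * by rewrite -comp_assoc pb_lift_1 comp_idl comp_idr.
      * by rewrite -!comp_assoc pb_lift_2 /= comp_assoc pb_lift_2 e !comp_assoc.
Defined.

Definition pull_square : NatTrans (compF (pull f) (pull b)) (compF (pull a) (pull g)).
Proof.
  refine {| app := pull_square_app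
    : forall A : Pt W, Hom (compF (pull f) (pull b) A) (compF (pull a) (pull g) A) |}.
  move=> A B h; apply: pt_hom_eq.
  apply: (pb_ext (P := pull_pb a (pull_ob g B))) => /=;
    rewrite !comp_assoc ?pb_lift_1 ?pb_lift_2 //.
  apply: (pb_ext (P := pull_pb g B)); rewrite !comp_assoc ?pb_lift_1 ?pb_lift_2.
  - by rewrite -!comp_assoc pb_lift_1 pb_lift_2 pb_lift_1.
  - rewrite -!comp_assoc !pb_lift_2 /= (comp_assoc (pb_2 (pull_pb b B))) pb_lift_2.
    by rewrite -comp_assoc.
Defined.

Lemma pull_square_iso : IsNatIso pull_square.
Proof.
  move=> A.
  pose Q := pull_pb a (pull_ob g A).
  pose P := pull_pb f (pull_ob b A).
  have E1 : b ∘ (f ∘ pb_1 Q) = pt_epi A ∘ (pb_2 (pull_pb g A) ∘ pb_2 Q).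
    rewrite comp_assoc -e -comp_assoc.
    have -> : a ∘ pb_1 Q = pb_1 (pull_pb g A) ∘ pb_2 Q := pb_comm Q.
    by rewrite !comp_assoc (pb_comm (pull_pb g A)).
  have E2 : f ∘ pb_1 Q = pt_epi (pull_ob b A) ∘ pb_lift (pull_pb b A) E1
    by rewrite /= pb_lift_1.
  pose k : Hom (pb_ob Q) (pb_ob P) := pb_lift P E2.
  pose h : Hom (pb_ob P) (pb_ob Q) := pt_map (pull_square_app A).
  have h1 : pb_1 Q ∘ h = pb_1 P by exact: pb_lift_1.
  have h2 : pb_2 (pull_pb g A) ∘ (pb_2 Q ∘ h) = pb_2 (pull_pb b A) ∘ pb_2 P.
    by rewrite /h /= pb_lift_2 pb_lift_2.
  have k1 : pb_1 P ∘ k = pb_1 Q by exact: pb_lift_1.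
  have k2 : pb_2 (pull_pb b A) ∘ (pb_2 P ∘ k) = pb_2 (pull_pb g A) ∘ pb_2 Q.
    by rewrite /k pb_lift_2 pb_lift_2.
  have kh : k ∘ h = idm (pb_ob P).
    apply: pb_ext; rewrite comp_idr comp_assoc ?k1 //.
    apply: (pb_ext (P := pull_pb b A)); last first.
      by rewrite !comp_assoc -(comp_assoc _ (pb_2 P)) k2 -!comp_assoc h2.
    rewrite -(pb_comm P : f ∘ pb_1 P = pb_1 (pull_pb b A) ∘ pb_2 P).
    rewrite !comp_assoc -(pb_comm P : f ∘ pb_1 P = pb_1 (pull_pb b A) ∘ pb_2 P).
    by rewrite -(comp_assoc f) k1 -comp_assoc h1.
  have hk : h ∘ k = idm (pb_ob Q).
    apply: pb_ext; rewrite comp_idr comp_assoc ?h1 //.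
    apply: (pb_ext (P := pull_pb g A)); last first.
      by rewrite !comp_assoc -(comp_assoc _ (pb_2 Q)) h2 -!comp_assoc k2.
    rewrite -(pb_comm Q : a ∘ pb_1 Q = pb_1 (pull_pb g A) ∘ pb_2 Q).
    rewrite !comp_assoc -(pb_comm Q : a ∘ pb_1 Q = pb_1 (pull_pb g A) ∘ pb_2 Q).
    by rewrite -(comp_assoc a) h1 -comp_assoc k1.
  have p1 : pt_epi (pull_ob f (pull_ob b A)) ∘ k = pt_epi (pull_ob a (pull_ob g A)).
    exact: k1.
  have p2 : k ∘ pt_sec (pull_ob a (pull_ob g A)) = pt_sec (pull_ob f (pull_ob b A)).
    rewrite -(pt_map_sec (pull_square_app A)) comp_assoc.
    by rewrite (kh : k ∘ pt_map (pull_square_app A) = _) comp_idl.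
  exists (@Build_PointHom C X (pull_ob a (pull_ob g A)) (pull_ob f (pull_ob b A)) k p1 p2).
  by split; apply: pt_hom_eq.
Qed.

(* The canonical comparison a_! f^* -> g^* b_!. *)
Definition beck_chevalley
  : NatTrans (compF (push a) (pull f)) (compF (pull g) (push b)) :=
  mate (push_pull_adj a) (push_pull_adj b) pull_square.

End BeckChevalley.
End ChangeOfBase.

(* Main.v *)
From Stdlib Require Import ssreflect.
Require Import Defs.

Set Implicit Arguments.
Unset Strict Implicit.
Unset Printing Implicit Defensive.

(** All arguments use generalized elements: a map [T -> X] is an element of
    [X], and an existence statement about elements is only expected to hold
    after precomposition with a regular epimorphism [T' -> T].  In this
    language the Goursat condition says that kernel pairs 3-permute: if
    [r x = r u], [s u = s v] and [r v = r y], then locally there are [u'], [v']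
    with [s x = s u'], [r u' = r v'] and [s v' = s y] ([goursatP]).

    Assume this.  Let [Z = X *_Y A] be a pullback of split epimorphisms, let
    [X -> U] and [A -> B] be regular epimorphisms over [Y -> W], and let
    [q : Z -> P] be a regular epimorphism onto an object over [U] and [B]
    such that the copies of [X] and [A] which the sections embed in [Z] have
    images in [P] that factor through [U] and [B].  Then
    [P = U *_W B] ([quotient_pullback]).  Two facts are needed.
    - Every pair [(u, v)] over [W] comes from [Z]: lifting [u] to [x] and [v]
      to [c], the pairs [(x, 0)] and [(0, c)] of [Z] are linked by a chain
      alternating between the kernel pair of [Z -> Y] and that of [q], and
      3-permuting this chain produces the two halves of a preimage.
    - Elements of [Z] with equal images in [U] and [B] have equal images in
      [P].  This is Gumm's shifting lemma, a known consequence of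
      3-permutability, used once along each projection.

    Both [beta_!] of a product of points and [alpha_! f^*] of a point are such
    a [P], so (i) implies (ii) and (iii).

    Conversely, (ii) or (iii), applied to a point [A] over [Y], shows that
    pairs in the kernel pair of [beta_! A -> W] lift locally to pairs in the
    kernel pair of [A -> Y].  Apply this with [beta] the image of [s] and
    [A] the kernel pair of [r], seen as a point over [X] by its first
    projection and its diagonal.  A zigzag [x r u s v r y] is a pair of
    elements [(u, x)], [(v, y)] of [A] whose classes in [beta_! A] have the
    same image; a lift of that pair is two elements [(c, u')], [(c, v')] with
    the same first component, so [u'] and [v'] are [r]-related, and the second
    projection, which descends to [beta_! A], gives [s x = s u'] and
    [s v' = s y] ([three_permutable_of_lifting]). *)

(** * Regular epimorphisms and local lifting *)

Lemma comp_cong (C : Category) (X Y Y' Z : C) (f : Hom Y Z) (g : Hom X Y)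
    (h : Hom Y' Z) (k : Hom X Y') :
  f ∘ g = h ∘ k -> forall T (x : Hom T X), f ∘ (g ∘ x) = h ∘ (k ∘ x).
Proof. by move=> E T x; rewrite !comp_assoc E. Qed.

Lemma comp_cong1 (C : Category) (X Y Z : C) (f : Hom Y Z) (g : Hom X Y) (h : Hom X Z) :
  f ∘ g = h -> forall T (x : Hom T X), f ∘ (g ∘ x) = h ∘ x.
Proof. by move=> E T x; rewrite comp_assoc E. Qed.

Section RegularEpis.
Variables (C : Category) (R : Regular C).

(** Membership in a subobject may be checked locally, since a regular
    epimorphism is orthogonal to every monomorphism. *)
Lemma mono_descent (X Y T S : C) (m : Hom X Y) (e : Hom T S) (w : Hom T X) (v : Hom S Y) :
  IsMono m -> IsRegularEpi e -> m ∘ w = v ∘ e -> exists d, m ∘ d = v.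
Proof.
  move=> mm re E; case: (re) => [K [k1 [k2 [ek U]]]].
  have [d [ed _]] : exists! d, d ∘ e = w.
    by apply: U; apply: mm; rewrite !comp_assoc E -!comp_assoc ek.
  exists d; apply: (regular_epi_epi re).
  by rewrite -comp_assoc ed.
Qed.

(** The image of [g ∘ f] is all of [Z], by orthogonality to [f] and then
    to [g]; so [g ∘ f] is, up to an isomorphism, its own image map. *)
Lemma regular_epi_comp (X Y Z : C) (g : Hom Y Z) (f : Hom X Y) :
  IsRegularEpi g -> IsRegularEpi f -> IsRegularEpi (g ∘ f).
Proof.
  move=> rg rf; have mm := image_monoP (R := R) (f := g ∘ f).
  have [d ed] := mono_descent mm rf (image_fact R (g ∘ f)).
  have [|n en] := @mono_descent _ _ _ _ _ g d (idm Z) mm rg.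
    by rewrite comp_idl.
  have ne : n ∘ image_mono R (g ∘ f) = idm _.
    by apply: mm; rewrite comp_assoc en comp_idl comp_idr.
  have [K [k1 [k2 [ek U]]]] := image_epi_regular R (g ∘ f).
  exists K, k1, k2; rewrite -[g ∘ f](image_fact R); split.
    by rewrite -!comp_assoc ek.
  move=> T a Ea; have [h [eh uh]] := U T a Ea.
  exists (h ∘ n); split; first by rewrite -comp_assoc (comp_cong1 ne) comp_idl.
  move=> h' eh'; rewrite (uh (h' ∘ image_mono R (g ∘ f))) -?comp_assoc //.
  by rewrite en comp_idr.
Qed.

Lemma idm_regular_epi (X : C) : IsRegularEpi (idm X).
Proof.
  exists X, (idm X), (idm X); split=> // T a _.
  by exists a; split=> [|h]; rewrite comp_idr.
Qed.

Lemma local_lift (X Y T : C) (q : Hom X Y) (y : Hom T Y) : IsRegularEpi q ->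
  exists (S : C) (e : Hom S T) (x : Hom S X), IsRegularEpi e /\ q ∘ x = y ∘ e.
Proof.
  move=> rq; pose P := pullback R q y.
  exists (pb_ob P), (pb_2 P), (pb_1 P).
  by split; [exact: (regular_epi_stable R (pbP P)) | exact: pb_comm].
Qed.

Lemma pushout_regular_epi (Y X W : C) (i : Hom Y X) (b : Hom Y W) (P : Pushout i b) :
  IsRegularEpi b -> IsRegularEpi (po_1 P).
Proof.
  move=> rb; case: (rb) => [K [k1 [k2 [ek U]]]].
  exists K, (i ∘ k1), (i ∘ k2); split.
    by rewrite !(comp_cong (po_comm P)) ek.
  move=> T a ea; have [|c [ec _]] := U T (a ∘ i); first by rewrite -!comp_assoc.
  exists (po_desc P (eq_sym ec)); split; first exact: po_desc_1.
  move=> h eh; apply: po_ext; rewrite ?po_desc_1 ?po_desc_2 ?eh //.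
  by apply: (regular_epi_epi rb); rewrite -comp_assoc -po_comm comp_assoc eh.
Qed.
End RegularEpis.

(** * Relations in terms of generalized elements *)

Section ThreePermutability.
Variables (C : Category) (R : Regular C).

Definition related (X Y : C) (S : Relation R X Y) (T : C) (x : Hom T X) (y : Hom T Y) : Prop :=
  exists w, rel_1 S ∘ w = x /\ rel_2 S ∘ w = y.

Lemma prod_ext (X Y T : C) (P : Product X Y) (h k : Hom T (prod_ob P)) :
  prod_1 P ∘ h = prod_1 P ∘ k -> prod_2 P ∘ h = prod_2 P ∘ k -> h = k.
Proof.
  move=> e1 e2; have [w [_ U]] := prodP P (prod_1 P ∘ k) (prod_2 P ∘ k).
  by rewrite -(U h (conj e1 e2)) -(U k (conj eq_refl eq_refl)).
Qed.

Lemma related_map (X Y : C) (S : Relation R X Y) (T : C) (x : Hom T X) (y : Hom T Y) w :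
  rel_map S ∘ w = prod_pair (product R X Y) x y -> related S x y.
Proof.
  by move=> E; exists w; rewrite /rel_1 /rel_2 -!comp_assoc E prod_pair_1 prod_pair_2.
Qed.

Lemma rel_le_related (X Y : C) (S S' : Relation R X Y) :
  (forall T (x : Hom T X) (y : Hom T Y), related S x y -> related S' x y) -> rel_le S S'.
Proof.
  move=> H; have [|w [e1 e2]] := H _ (rel_1 S) (rel_2 S).
    by exists (idm _); rewrite !comp_idr.
  by exists w; apply: prod_ext; rewrite comp_assoc.
Qed.

Lemma related_le (X Y : C) (S S' : Relation R X Y) T (x : Hom T X) (y : Hom T Y) :
  rel_le S S' -> related S x y -> related S' x y.
Proof.
  move=> [u eu] [w [<- <-]]; exists (u ∘ w).
  by rewrite /rel_1 /rel_2 -!comp_assoc (comp_cong1 eu).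
Qed.

Lemma related_comp_rel (X Y Z : C) (S : Relation R X Y) (S' : Relation R Y Z)
    T (x : Hom T X) (z : Hom T Z) :
  related (rel_comp S S') x z <->
  exists (T' : C) (e : Hom T' T) (y : Hom T' Y),
    IsRegularEpi e /\ related S (x ∘ e) y /\ related S' y (z ∘ e).
Proof.
  rewrite /rel_comp; set P := pullback R _ _; set h := prod_pair _ _ _.
  have mh : image_mono R h ∘ image_epi R h = h by exact: image_fact.
  have h1 : prod_1 (product R X Z) ∘ h = rel_1 S ∘ pb_1 P by exact: prod_pair_1.
  have h2 : prod_2 (product R X Z) ∘ h = rel_2 S' ∘ pb_2 P by exact: prod_pair_2.
  split.
  - move=> [w [<- <-]].
    have [T' [e [p [re ep]]]] := local_lift R w (image_epi_regular R h).
    exists T', e, (rel_2 S ∘ (pb_1 P ∘ p)); split=> //.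
    have q1 : prod_1 (product R X Z) ∘ (image_mono R h ∘ (w ∘ e)) = rel_1 S ∘ (pb_1 P ∘ p).
      by rewrite -ep (comp_cong1 mh) (comp_cong h1).
    have q2 : prod_2 (product R X Z) ∘ (image_mono R h ∘ (w ∘ e)) = rel_2 S' ∘ (pb_2 P ∘ p).
      by rewrite -ep (comp_cong1 mh) (comp_cong h2).
    split; [exists (pb_1 P ∘ p)|exists (pb_2 P ∘ p)]; split=> //.
    + by rewrite -q1 /rel_1 /= -!comp_assoc.
    + by rewrite (comp_cong (pb_comm P)).
    + by rewrite -q2 /rel_2 /= -!comp_assoc.
  - move=> [T' [e [y [re [[v [v1 v2]] [v' [v'1 v'2]]]]]]].
    have E : rel_2 S ∘ v = rel_1 S' ∘ v' by rewrite v2 v'1.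
    have [|d ed] := @mono_descent C _ _ _ _ (image_mono R h) e
        (image_epi R h ∘ pb_lift P E) (prod_pair (product R X Z) x z)
        (image_monoP (R := R) (f := h)) re.
      rewrite (comp_cong1 mh); apply: prod_ext.
        by rewrite (comp_cong h1) pb_lift_1 v1 (comp_cong1 (prod_pair_1 _ _ _)).
      by rewrite (comp_cong h2) pb_lift_2 v'2 (comp_cong1 (prod_pair_2 _ _ _)).
    exact: (@related_map X Z (rel_comp S S') T x z d ed).
Qed.

Lemma related_precomp (X Y : C) (S : Relation R X Y) T T' (x : Hom T X) (y : Hom T Y)
    (e : Hom T' T) : related S x y -> related S (x ∘ e) (y ∘ e).
Proof. by move=> [w [<- <-]]; exists (w ∘ e); rewrite !comp_assoc. Qed.

Lemma related_kernel (X A : C) (r : Hom X A) (S : Relation R X X) :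
  IsKernelPair r (rel_1 S) (rel_2 S) ->
  forall T (x y : Hom T X), related S x y <-> r ∘ x = r ∘ y.
Proof.
  move=> [e U] T x y; split; first by move=> [w [<- <-]]; exact: comp_cong.
  by move=> E; have [w [ew _]] := U T x y E; exists w.
Qed.

Lemma related_comp3 (X : C) (S S' : Relation R X X) T (x y : Hom T X) :
  related (rel_comp (rel_comp S S') S) x y <->
  exists (T' : C) (e : Hom T' T) (u v : Hom T' X), IsRegularEpi e /\
    related S (x ∘ e) u /\ related S' u v /\ related S v (y ∘ e).
Proof.
  split.
  - move/related_comp_rel=> [T1 [e1 [v [r1 [/related_comp_rel H Hv]]]]].
    have [T2 [e2 [u [r2 [H1 H2]]]]] := H.
    exists T2, (e1 ∘ e2), u, (v ∘ e2); rewrite !comp_assoc.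
    split; first exact: regular_epi_comp.
    by do 2!split=> //; exact: related_precomp.
  - move=> [T' [e [u [v [re [Hx [Hu Hy]]]]]]].
    apply/related_comp_rel; exists T', e, v; do 2!split=> //.
    apply/related_comp_rel; exists T', (idm T'), u.
    rewrite !comp_idr; split=> //.
    exact: idm_regular_epi.
Qed.

(** The inclusion of [Eq r ∘ Eq s ∘ Eq r] in [Eq s ∘ Eq r ∘ Eq s], where
    [Eq] denotes the kernel pair, stated for generalized elements. *)
Definition ThreePermutable (X A B : C) (r : Hom X A) (s : Hom X B) : Prop :=
  forall T (x u v y : Hom T X), r ∘ x = r ∘ u -> s ∘ u = s ∘ v -> r ∘ v = r ∘ y ->
  exists (T' : C) (e : Hom T' T) (u' v' : Hom T' X), IsRegularEpi e /\
    s ∘ (x ∘ e) = s ∘ u' /\ r ∘ u' = r ∘ v' /\ s ∘ v' = s ∘ (y ∘ e).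

Definition kernel_rel (X A : C) (r : Hom X A) : Relation R X X.
Proof.
  refine {| rel_map := prod_pair (product R X X) (pb_1 (pullback R r r)) (pb_2 (pullback R r r)) |}.
  move=> T u v E; apply: pb_ext.
  - by rewrite -(prod_pair_1 (product R X X) (pb_1 _) (pb_2 _)) -!comp_assoc E.
  - by rewrite -(prod_pair_2 (product R X X) (pb_1 _) (pb_2 _)) -!comp_assoc E.
Defined.

Lemma kernel_relP (X A : C) (r : Hom X A) :
  IsKernelPair r (rel_1 (kernel_rel r)) (rel_2 (kernel_rel r)).
Proof. by rewrite /rel_1 /rel_2 prod_pair_1 prod_pair_2; exact: pbP. Qed.

Lemma kernel_rel_effective (X A : C) (r : Hom X A) : IsEffectiveEquivalence (kernel_rel r).
Proof.
  have K := kernel_relP r; have E := related_kernel K.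
  split; last by exists A, r.
  split; last split.
  - by have [w ew] := proj2 (E X (idm X) (idm X)) eq_refl; exists w.
  - have [w ew] := proj2 (E _ (rel_2 (kernel_rel r)) (rel_1 (kernel_rel r))) (eq_sym (proj1 K)).
    by exists w.
  - move=> P; apply: (proj2 (E _ _ _)).
    by rewrite (comp_cong (proj1 K)) (pb_comm P) (comp_cong (proj1 K)).
Qed.

(** One inclusion suffices on the right because [r] and [s] may be
    exchanged. *)
Lemma goursatP : IsGoursat R <->
  forall (X A B : C) (r : Hom X A) (s : Hom X B), ThreePermutable r s.
Proof.
  split.
  - move=> G X A B r s T x u v y xu uv vy.
    have Kr := related_kernel (kernel_relP r); have Ks := related_kernel (kernel_relP s).
    have [le _] := G X _ _ (kernel_rel_effective r) (kernel_rel_effective s).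
    have H : related (rel_comp (rel_comp (kernel_rel r) (kernel_rel s)) (kernel_rel r)) x y.
      apply/related_comp_rel; exists T, (idm T), v; rewrite !comp_idr.
      have ri := idm_regular_epi T.
      split=> //; split; last exact/Kr.
      apply/related_comp_rel; exists T, (idm T), u; rewrite !comp_idr.
      by split=> //; split; [apply/Kr | apply/Ks].
    have [T' [e [u' [v' [re [/Ks H1 [/Kr H2 /Ks H3]]]]]]] :=
      proj1 (related_comp3 _ _ _ _) (related_le le H).
    by exists T', e, u', v'.
  - move=> H.
    have le : forall (X : C) (S T : Relation R X X), IsEffectiveEquivalence S ->
        IsEffectiveEquivalence T ->
        rel_le (rel_comp (rel_comp S T) S) (rel_comp (rel_comp T S) T).
      move=> X S S' [_ [A [r /related_kernel Kr]]] [_ [B [s /related_kernel Ks]]].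
      apply: rel_le_related => T x y /related_comp3.
      move=> [T1 [e1 [u [v [r1 [/Kr xu [/Ks uv /Kr vy]]]]]]].
      have [T2 [e2 [u' [v' [r2 [xu' [uv' vy']]]]]]] := H _ _ _ _ _ _ _ _ _ _ xu uv vy.
      apply/related_comp3; exists T2, (e1 ∘ e2), u', v'.
      split; first exact: regular_epi_comp.
      rewrite !comp_assoc.
      by split; [exact/Ks|split; [exact/Kr|exact/Ks]].
    by move=> X S T hS hT; split; apply: le.
Qed.

(** Maps with the same kernel pair 3-permute with the same maps; this reduces
    to the case where [s] is a regular epimorphism. *)
Lemma three_permutable_image (X A B : C) (r : Hom X A) (s : Hom X B) :
  ThreePermutable r (image_epi R s) -> ThreePermutable r s.
Proof.
  have ms : image_mono R s ∘ image_epi R s = s by exact: image_fact.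
  move=> H T x u v y xu uv vy.
  have uv' : image_epi R s ∘ u = image_epi R s ∘ v.
    by apply: (image_monoP (R := R) (f := s)); rewrite !(comp_cong1 ms).
  have [T' [e [u' [v' [re [E1 [E2 E3]]]]]]] := H _ _ _ _ _ xu uv' vy.
  exists T', e, u', v'; split=> //.
  by split; last split=> //; rewrite -!(comp_cong1 ms) ?E1 ?E3.
Qed.
End ThreePermutability.

(** * Products of points are pullbacks *)

Section PointProducts.
Variables (C : Category) (L : FinitelyComplete C) (Y : C).

Section ProductPoint.
Variables (A B : Point Y).

Let Q := pullback L (pt_epi A) (pt_epi B).

Lemma product_point_sec_eq : pt_epi A ∘ pt_sec A = pt_epi B ∘ pt_sec B.
Proof. by rewrite !pt_split. Qed.

Definition product_point : Point Y.
Proof.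
  refine {| pt_ob := pb_ob Q; pt_epi := pt_epi A ∘ pb_1 Q;
            pt_sec := pb_lift Q product_point_sec_eq |}.
  by rewrite -comp_assoc pb_lift_1 pt_split.
Defined.

Definition product_fst : PointHom product_point A.
Proof.
  refine {| pt_map := pb_1 Q : Hom (pt_ob product_point) (pt_ob A) |} => //=.
  exact: pb_lift_1.
Defined.

Definition product_snd : PointHom product_point B.
Proof.
  refine {| pt_map := pb_2 Q : Hom (pt_ob product_point) (pt_ob B) |} => /=.
  - by rewrite -pb_comm.
  - exact: pb_lift_2.
Defined.
End ProductPoint.

Lemma pullback_point_product (A B P : Pt Y) (p1 : Hom P A) (p2 : Hom P B) :
  IsPullback (pt_epi A) (pt_epi B) (pt_map p1) (pt_map p2) -> IsProduct p1 p2.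
Proof.
  move=> PB T a b; pose P' := Build_Pullback PB.
  have E : pt_epi A ∘ pt_map a = pt_epi B ∘ pt_map b by rewrite !pt_map_epi.
  have h1 : pt_map p1 ∘ pb_lift P' E = pt_map a := pb_lift_1 P' E.
  have h2 : pt_map p2 ∘ pb_lift P' E = pt_map b := pb_lift_2 P' E.
  have e1 : pt_epi P ∘ pb_lift P' E = pt_epi T.
    by rewrite -(pt_map_epi p1) -comp_assoc h1 pt_map_epi.
  have e2 : pb_lift P' E ∘ pt_sec T = pt_sec P.
    by apply: (pb_ext (P := P')) => /=;
      rewrite comp_assoc ?h1 ?h2 !pt_map_sec.
  exists (Build_PointHom e1 e2 : Hom (c := Pt Y) T P); split.
    by split; apply: pt_hom_eq.
  move=> k [k1 k2]; apply: pt_hom_eq; apply: (pb_ext (P := P')) => /=.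
  - by rewrite h1 -k1.
  - by rewrite h2 -k2.
Qed.

(** The universal property of a product only speaks of cones of points, so it
    does not give the pullback property directly; it is transported from the
    canonical product along the comparison isomorphism. *)
Lemma product_point_pullback (A B P : Pt Y) (p1 : Hom P A) (p2 : Hom P B) :
  IsProduct p1 p2 -> IsPullback (pt_epi A) (pt_epi B) (pt_map p1) (pt_map p2).
Proof.
  move=> H; split; first by rewrite !pt_map_epi.
  move=> T a b E; pose Q : Pt Y := product_point A B.
  pose q1 : Hom Q A := product_fst A B; pose q2 : Hom Q B := product_snd A B.
  have [t [[t1 t2] _]] := H Q q1 q2.
  have [k [[k1 k2] _]] : exists! k : Hom P Q, q1 ∘ k = p1 /\ q2 ∘ k = p2.
    exact: (@pullback_point_product A B Q q1 q2 (pbP (pullback L (pt_epi A) (pt_epi B)))).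
  have tk : t ∘ k = idm P.
    have [w [_ U]] := H P p1 p2.
    rewrite -(U (t ∘ k)) ?(U (idm P)) ?comp_idr //.
    by rewrite !comp_assoc t1 t2.
  have t1' : pt_map p1 ∘ pt_map t = pb_1 _ := f_equal (@pt_map _ _ _ _) t1.
  have t2' : pt_map p2 ∘ pt_map t = pb_2 _ := f_equal (@pt_map _ _ _ _) t2.
  have k1' : pb_1 _ ∘ pt_map k = pt_map p1 := f_equal (@pt_map _ _ _ _) k1.
  have k2' : pb_2 _ ∘ pt_map k = pt_map p2 := f_equal (@pt_map _ _ _ _) k2.
  have tk' : pt_map t ∘ pt_map k = idm _ := f_equal (@pt_map _ _ _ _) tk.
  exists (pt_map t ∘ pb_lift (pullback L (pt_epi A) (pt_epi B)) E); split.
    by rewrite (comp_cong1 t1') (comp_cong1 t2') pb_lift_1 pb_lift_2.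
  move=> h [h1 h2]; rewrite -[h]comp_idl -tk' -comp_assoc; congr (_ ∘ _).
  apply: pb_ext; rewrite ?pb_lift_1 ?pb_lift_2.
  - by rewrite (comp_cong1 k1').
  - by rewrite (comp_cong1 k2').
Qed.
End PointProducts.

(** * Quotients of pullbacks in the presence of 3-permutability *)

(** Throughout, elements of [Z] are pairs [(x, c)] with [f x = h c].  The maps
    [lx] and [la] embed [X] and [A] as pairs written [(x, 0)] and [(0, c)]; in
    the applications [0] is given by the splittings.  The maps [su] and [sb]
    express that [q] identifies [(x, 0)] with [(x', 0)] when [a x = a x'], and
    [(0, c)] with [(0, c')] when [p c = p c']. *)
Section PullbackQuotient.
Variables (C : Category) (R : Regular C).
Hypothesis perm : forall (X A B : C) (r : Hom X A) (s : Hom X B), ThreePermutable r s.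

Variables (X Y A U W B P : C).
Variables (f : Hom X Y) (i : Hom Y X) (h : Hom A Y) (Z : Pullback f h).
Variables (lx : Hom X (pb_ob Z)) (la : Hom A (pb_ob Z)).
Hypotheses (fi : f ∘ i = idm Y) (lx1 : pb_1 Z ∘ lx = idm X) (la1 : pb_1 Z ∘ la = i ∘ h)
  (la2 : pb_2 Z ∘ la = idm A).

Variables (g : Hom U W) (j : Hom W U) (k : Hom B W).
Variables (a : Hom X U) (b : Hom Y W) (p : Hom A B) (q : Hom (pb_ob Z) P).
Variables (q1 : Hom P U) (q2 : Hom P B) (su : Hom U P) (sb : Hom B P).
Hypotheses (ga : g ∘ a = b ∘ f) (kp : k ∘ p = b ∘ h) (ai : a ∘ i = j ∘ b).
Hypotheses (ra : IsRegularEpi a) (rp : IsRegularEpi p) (rq : IsRegularEpi q).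
Hypotheses (q1q : q1 ∘ q = a ∘ pb_1 Z) (q2q : q2 ∘ q = p ∘ pb_2 Z).
Hypotheses (qlx : q ∘ lx = su ∘ a) (qla : q ∘ la = sb ∘ p).

Let fp : f ∘ pb_1 Z = h ∘ pb_2 Z := pb_comm Z.

(** From the chain [(x, 0), (0, 0), (0', 0'), (0', c)], whose steps lie in the
    kernel pairs of [Z -> Y], of [q] and of [Z -> Y], 3-permutability yields
    [z1] and [z2] over the same element of [Y], with [q z1 = q (x, 0)] and
    [q z2 = q (0', c)].  The first component of [z1] and the second of [z2]
    form the preimage. *)
Lemma quotient_jointly_covers (T : C) (u : Hom T U) (v : Hom T B) : g ∘ u = k ∘ v ->
  exists (T' : C) (e : Hom T' T) (z : Hom T' (pb_ob Z)),
    IsRegularEpi e /\ q1 ∘ (q ∘ z) = u ∘ e /\ q2 ∘ (q ∘ z) = v ∘ e.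
Proof.
  move=> E.
  have [T1 [e1 [x [r1 ex]]]] := local_lift R u ra.
  have [T2 [e2 [c [r2 ec]]]] := local_lift R (v ∘ e1) rp.
  (* [m] is [y |-> (0, 0)] over [y]. *)
  have [m em] : exists m, m = lx ∘ i by eexists.
  have fm : f ∘ (pb_1 Z ∘ m) = idm Y by rewrite em (comp_cong1 lx1) comp_idl fi.
  have bxc : b ∘ (f ∘ (x ∘ e2)) = b ∘ (h ∘ c).
    rewrite -(comp_cong ga) -(comp_cong kp) ec (comp_cong1 ex) -!comp_assoc.
    by rewrite (comp_cong E).
  have s1 : (f ∘ pb_1 Z) ∘ (lx ∘ (x ∘ e2)) = (f ∘ pb_1 Z) ∘ (m ∘ (f ∘ (x ∘ e2))).
    by rewrite -!comp_assoc (comp_cong1 lx1) comp_idl (comp_assoc _ m) (comp_cong1 fm) comp_idl.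
  have s2 : q ∘ (m ∘ (f ∘ (x ∘ e2))) = q ∘ (m ∘ (h ∘ c)).
    by rewrite em -!comp_assoc !(comp_cong qlx) !(comp_cong ai) bxc.
  have s3 : (f ∘ pb_1 Z) ∘ (m ∘ (h ∘ c)) = (f ∘ pb_1 Z) ∘ (la ∘ c).
    rewrite -!comp_assoc (comp_assoc _ m) (comp_cong1 fm) (comp_cong la1).
    by rewrite (comp_cong1 fi).
  have [T3 [e3 [z1 [z2 [r3 [E1 [E2 E3]]]]]]] := perm s1 s2 s3.
  have Ez : f ∘ (pb_1 Z ∘ z1) = h ∘ (pb_2 Z ∘ z2).
    by rewrite comp_assoc E2 fp comp_assoc.
  exists T3, (e1 ∘ (e2 ∘ e3)), (pb_lift Z Ez); split.
    by apply: (regular_epi_comp R) => //; exact: (regular_epi_comp R).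
  rewrite (comp_cong q1q) (comp_cong q2q) pb_lift_1 pb_lift_2; split.
  - rewrite -(comp_cong q1q) -E1 -!comp_assoc (comp_cong q1q) (comp_cong1 lx1) comp_idl.
    by rewrite (comp_cong ex).
  - rewrite -(comp_cong q2q) E3 -!comp_assoc (comp_cong q2q) (comp_cong1 la2) comp_idl.
    by rewrite (comp_cong ec) -!comp_assoc.
Qed.

(** An instance of the shifting lemma.  The chain from [(x, c)] through
    [(0, c)] and [(0, c')] to [(x, c')] has its outer steps in the kernel pair
    of the second projection; its middle step lies in the kernel pairs of both
    [q] and the first projection.  After 3-permutation, the two inner elements
    [z1] and [z2] agree in both components. *)
Lemma quotient_separates_fibre (T : C) (z z' : Hom T (pb_ob Z)) :
  pb_1 Z ∘ z = pb_1 Z ∘ z' -> p ∘ (pb_2 Z ∘ z) = p ∘ (pb_2 Z ∘ z') -> q ∘ z = q ∘ z'.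
Proof.
  move=> E1 E2; pose D := product R X P.
  have s1 : pb_2 Z ∘ z = pb_2 Z ∘ (la ∘ (pb_2 Z ∘ z)) by rewrite (comp_cong1 la2) comp_idl.
  have s2 : prod_pair D (pb_1 Z) q ∘ (la ∘ (pb_2 Z ∘ z))
          = prod_pair D (pb_1 Z) q ∘ (la ∘ (pb_2 Z ∘ z')).
    apply: (prod_ext (P := D)).
      rewrite !(comp_cong1 (prod_pair_1 _ _ _)) !(comp_cong la1).
      by rewrite -!(comp_cong fp) E1.
    by rewrite !(comp_cong1 (prod_pair_2 _ _ _)) !(comp_cong qla) E2.
  have s3 : pb_2 Z ∘ (la ∘ (pb_2 Z ∘ z')) = pb_2 Z ∘ z' by rewrite (comp_cong1 la2) comp_idl.
  have [T' [e [z1 [z2 [re [F1 [F2 F3]]]]]]] := perm s1 s2 s3.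
  have G1 := f_equal (comp (prod_1 D)) F1; have G2 := f_equal (comp (prod_2 D)) F1.
  have H1 := f_equal (comp (prod_1 D)) F3; have H2 := f_equal (comp (prod_2 D)) F3.
  move: G1 G2 H1 H2; rewrite !(comp_cong1 (prod_pair_1 _ _ _)) !(comp_cong1 (prod_pair_2 _ _ _)).
  move=> G1 G2 H1 H2.
  have ez : z1 = z2.
    by apply: pb_ext; rewrite // -G1 H1 !comp_assoc E1.
  by apply: (regular_epi_epi re); rewrite -!comp_assoc G2 ez.
Qed.

(** A second shift, along the first projection: the chain from [(x, c)] through
    [(x, 0)] and [(x', 0)] to [(x', c')] is replaced by one whose inner elements
    have the same first component, which is the case already treated. *)
Lemma quotient_jointly_monic (T : C) (u v : Hom T P) :
  q1 ∘ u = q1 ∘ v -> q2 ∘ u = q2 ∘ v -> u = v.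
Proof.
  move=> E1 E2.
  have [T1 [e1 [z [r1 ez]]]] := local_lift R u rq.
  have [T2 [e2 [z' [r2 ez']]]] := local_lift R (v ∘ e1) rq.
  have F1 : a ∘ (pb_1 Z ∘ (z ∘ e2)) = a ∘ (pb_1 Z ∘ z').
    by rewrite -!(comp_cong q1q) ez' (comp_cong ez) -!comp_assoc (comp_cong E1).
  have F2 : p ∘ (pb_2 Z ∘ (z ∘ e2)) = p ∘ (pb_2 Z ∘ z').
    by rewrite -!(comp_cong q2q) ez' (comp_cong ez) -!comp_assoc (comp_cong E2).
  suff K : q ∘ (z ∘ e2) = q ∘ z'.
    apply: (regular_epi_epi r1); apply: (regular_epi_epi r2).
    by rewrite -ez' -K comp_assoc ez.
  have s1 : pb_1 Z ∘ (z ∘ e2) = pb_1 Z ∘ (lx ∘ (pb_1 Z ∘ (z ∘ e2))).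
    by rewrite (comp_cong1 lx1) comp_idl.
  have s2 : q ∘ (lx ∘ (pb_1 Z ∘ (z ∘ e2))) = q ∘ (lx ∘ (pb_1 Z ∘ z')).
    by rewrite !(comp_cong qlx) F1.
  have s3 : pb_1 Z ∘ (lx ∘ (pb_1 Z ∘ z')) = pb_1 Z ∘ z' by rewrite (comp_cong1 lx1) comp_idl.
  have [T3 [e3 [z1 [z2 [r3 [G1 [G2 G3]]]]]]] := perm s1 s2 s3.
  apply: (regular_epi_epi r3); rewrite -!(comp_assoc q) G1 -G3.
  apply: quotient_separates_fibre => //.
  rewrite -!(comp_cong q2q) -G1 G3 !(comp_cong q2q).
  by rewrite !(comp_assoc _ _ e3) F2.
Qed.

(** Joint monicity makes the local preimages in [P] agree on overlaps, so they
    descend to a global one. *)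
Lemma quotient_pullback : IsPullback g k q1 q2.
Proof.
  split.
    by apply: (regular_epi_epi rq); rewrite -!comp_assoc q1q q2q (comp_cong ga) fp (comp_cong kp).
  move=> T u v E.
  have [T' [e [z [re [E1 E2]]]]] := quotient_jointly_covers E.
  case: (re) => [K [k1 [k2 [ek D]]]].
  have qk : q ∘ z ∘ k1 = q ∘ z ∘ k2.
    apply: quotient_jointly_monic.
      by rewrite !comp_assoc -(comp_assoc q1) E1 -!comp_assoc ek.
    by rewrite !comp_assoc -(comp_assoc q2) E2 -!comp_assoc ek.
  have [w [ew _]] := D _ _ qk.
  have w1 : q1 ∘ w = u by apply: (regular_epi_epi re); rewrite -comp_assoc ew.
  have w2 : q2 ∘ w = v by apply: (regular_epi_epi re); rewrite -comp_assoc ew.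
  exists w; split=> // w' [w'1 w'2].
  by apply: quotient_jointly_monic; rewrite ?w1 ?w2.
Qed.
End PullbackQuotient.

(** * Lifting kernel pairs implies the Goursat condition *)

Section KernelPairLifting.
Variables (C : Category) (R : Regular C) (Po : PushoutsAlongSplitMonos C).

Definition LiftsKernelPair (Y W : C) (b : Hom Y W) (A : Point Y) : Prop :=
  forall T (u u' : Hom T (pt_ob (push_ob Po b A))),
  pt_epi (push_ob Po b A) ∘ u = pt_epi (push_ob Po b A) ∘ u' ->
  exists (T' : C) (e : Hom T' T) (w w' : Hom T' (pt_ob A)), IsRegularEpi e /\
    pt_epi A ∘ w = pt_epi A ∘ w' /\
    po_1 (push_po Po b A) ∘ w = u ∘ e /\ po_1 (push_po Po b A) ∘ w' = u' ∘ e.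

(** If a regular quotient of a cone [Z] over two copies of [A] is the kernel
    pair of the pushed-forward point, pairs lift through [Z]. *)
Lemma lifts_kernel_pair_of_pullback (Y W Z P : C) (b : Hom Y W) (A : Point Y)
    (z1 z2 : Hom Z (pt_ob A)) (q : Hom Z P) (q1 q2 : Hom P (pt_ob (push_ob Po b A))) :
  pt_epi A ∘ z1 = pt_epi A ∘ z2 -> IsRegularEpi q ->
  IsPullback (pt_epi (push_ob Po b A)) (pt_epi (push_ob Po b A)) q1 q2 ->
  q1 ∘ q = po_1 (push_po Po b A) ∘ z1 -> q2 ∘ q = po_1 (push_po Po b A) ∘ z2 ->
  LiftsKernelPair b A.
Proof.
  move=> ez rq [_ PB] E1 E2 T u u' /PB [v [[<- <-] _]].
  have [T' [e [w [re ew]]]] := local_lift R v rq.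
  exists T', e, (z1 ∘ w), (z2 ∘ w); split=> //.
  by rewrite -(comp_cong E1) -(comp_cong E2) ew !comp_assoc ez.
Qed.

Section KernelPoint.
Variables (X A : C) (r : Hom X A).

(** A relation from [X] to itself that is reflexive is a point over [X]: the
    first projection is split by the diagonal. *)
Definition kernel_point : Point X :=
  {| pt_ob := pb_ob (pullback R r r);
     pt_epi := pb_1 (pullback R r r);
     pt_sec := pb_lift (pullback R r r) (eq_refl (r ∘ idm X));
     pt_split := pb_lift_1 _ _ |}.

Lemma three_permutable_of_lifting (B : C) (s : Hom X B) :
  LiftsKernelPair s kernel_point -> ThreePermutable r s.
Proof.
  move=> H T x u v y xu uv vy.
  pose K := pullback R r r; pose Q := push_po Po s kernel_point.
  have tE : (s ∘ pb_2 K) ∘ pt_sec kernel_point = idm B ∘ s.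
    by rewrite -comp_assoc pb_lift_2 comp_idl comp_idr.
  (* The second projection of the kernel pair descends to the pushout
     because it, too, is split by the diagonal. *)
  pose t := po_desc Q tE.
  have t1 : t ∘ po_1 Q = s ∘ pb_2 K := po_desc_1 Q tE.
  have g1 : pt_epi (push_ob Po s kernel_point) ∘ po_1 Q = s ∘ pb_1 K by exact: po_desc_1.
  pose ux := pb_lift K (eq_sym xu); pose vy' := pb_lift K vy.
  have E : pt_epi (push_ob Po s kernel_point) ∘ (po_1 Q ∘ ux)
         = pt_epi (push_ob Po s kernel_point) ∘ (po_1 Q ∘ vy').
    by rewrite !(comp_cong g1) !pb_lift_1.
  have [T' [e [w [w' [re [E1 [E2 E3]]]]]]] := H T _ _ E.
  have r12 : r ∘ pb_1 K = r ∘ pb_2 K := pb_comm K.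
  exists T', e, (pb_2 K ∘ w), (pb_2 K ∘ w'); split=> //; split; last split.
  - by rewrite -(comp_cong t1) E2 -comp_assoc (comp_cong t1) (comp_cong1 (pb_lift_2 K _)).
  - by rewrite -!(comp_cong r12); congr (_ ∘ _).
  - by rewrite -(comp_cong t1) E3 -comp_assoc (comp_cong t1) (comp_cong1 (pb_lift_2 K _)).
Qed.
End KernelPoint.

Lemma goursat_of_lifting :
  (forall (Y W : C) (b : Hom Y W) (A : Point Y), IsRegularEpi b -> LiftsKernelPair b A) ->
  IsGoursat R.
Proof.
  move=> H; apply/goursatP => X A B r s; apply: (three_permutable_image (R := R)).
  by apply: three_permutable_of_lifting; apply: H; exact: image_epi_regular.
Qed.
End KernelPairLifting.

(** * Change of base and binary products *)

Section Products.
Variables (C : Category) (R : Regular C) (Po : PushoutsAlongSplitMonos C).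

Definition zero_point_map (Y : C) (A B : Point Y) : PointHom A B.
Proof.
  refine {| pt_map := pt_sec B ∘ pt_epi A |}.
  - by rewrite comp_assoc pt_split comp_idl.
  - by rewrite -comp_assoc pt_split comp_idr.
Defined.

(** The embeddings of the two factors in the product are themselves maps of
    points, so pushing them forward yields the factorizations that
    [quotient_pullback] requires. *)
Lemma goursat_push_products (Y W : C) (b : Hom Y W) :
  IsGoursat R -> IsRegularEpi b -> PreservesBinaryProducts (push Po b).
Proof.
  move=> /goursatP G rb X A P p1 p2 H; apply: pullback_point_product.
  pose Z := Build_Pullback (product_point_pullback R H).
  have [lx [[lx1 _] _]] := H X (idm X) (zero_point_map X A).
  have [la [[la1 la2] _]] := H A (zero_point_map A X) (idm A).
  have lift D E (h : Hom (c := Pt Y) D E) :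
      pt_map (fmap (push Po b) h) ∘ po_1 (push_po Po b D) = po_1 (push_po Po b E) ∘ pt_map h.
    exact: po_desc_1.
  have lx1' : pb_1 Z ∘ pt_map lx = idm _ := f_equal (@pt_map _ _ _ _) lx1.
  have la1' : pb_1 Z ∘ pt_map la = _ := f_equal (@pt_map _ _ _ _) la1.
  have la2' : pb_2 Z ∘ pt_map la = idm _ := f_equal (@pt_map _ _ _ _) la2.
  have epi D : pt_epi (push Po b D) ∘ po_1 (push_po Po b D) = b ∘ pt_epi D by exact: po_desc_1.
  exact: (quotient_pullback R G (pt_split X) lx1' la1' la2' (epi X) (epi A)
    (po_comm (push_po Po b X)) (pushout_regular_epi _ rb) (pushout_regular_epi _ rb)
    (pushout_regular_epi (push_po Po b P) rb) (lift _ _ p1) (lift _ _ p2)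
    (eq_sym (lift _ _ lx)) (eq_sym (lift _ _ la))).
Qed.

Lemma push_products_lifting (Y W : C) (b : Hom Y W) (A : Point Y) :
  IsRegularEpi b -> PreservesBinaryProducts (push Po b) -> LiftsKernelPair Po b A.
Proof.
  move=> rb H; pose Z : Pt Y := product_point R A A.
  pose z1 : Hom Z (A : Pt Y) := product_fst R A A; pose z2 : Hom Z (A : Pt Y) := product_snd R A A.
  have PB := pbP (pullback R (pt_epi A) (pt_epi A)).
  have HZ := product_point_pullback R (H _ _ _ _ _ (@pullback_point_product _ _ _ _ Z z1 z2 PB)).
  apply: (lifts_kernel_pair_of_pullback R (proj1 PB) (pushout_regular_epi (push_po Po b Z) rb) HZ).
  - exact: po_desc_1.
  - exact: po_desc_1.
Qed.
End Products.

(** * The Beck-Chevalley comparison *)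

Section BeckChevalley.
Variables (C : Category) (R : Regular C) (Po : PushoutsAlongSplitMonos C).

Lemma pt_iso (Y : C) (A B : Pt Y) (h : Hom A B) : IsIso h <-> IsIso (pt_map h).
Proof.
  split.
    by move=> [k [kh hk]]; exists (pt_map k); split;
      [exact: (f_equal (@pt_map _ _ _ _) kh) | exact: (f_equal (@pt_map _ _ _ _) hk)].
  move=> [k [kh hk]].
  have k1 : pt_epi A ∘ k = pt_epi B by rewrite -(pt_map_epi h) -comp_assoc hk comp_idr.
  have k2 : k ∘ pt_sec B = pt_sec A by rewrite -(pt_map_sec h) comp_assoc kh comp_idl.
  exists (Build_PointHom k1 k2 : Hom (c := Pt Y) B A).
  by split; apply: pt_hom_eq.
Qed.

Lemma pullback_comparison (X Y Z P : C) (f : Hom X Z) (g : Hom Y Z) (Q : Pullback f g)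
    (m : Hom P (pb_ob Q)) :
  IsIso m <-> IsPullback f g (pb_1 Q ∘ m) (pb_2 Q ∘ m).
Proof.
  split.
  - move=> [n [nm mn]]; split; first by rewrite !comp_assoc pb_comm.
    move=> T a b E; exists (n ∘ pb_lift Q E); split.
      by rewrite -!comp_assoc !(comp_cong1 mn) !comp_idl pb_lift_1 pb_lift_2.
    move=> h [h1 h2]; rewrite -[h]comp_idl -nm -comp_assoc; congr (_ ∘ _).
    by apply: pb_ext; rewrite ?pb_lift_1 ?pb_lift_2 comp_assoc.
  - move=> [_ U]; have [n [[n1 n2] _]] := U _ _ _ (pb_comm Q).
    have mn : m ∘ n = idm _ by apply: pb_ext; rewrite comp_assoc comp_idr.
    have [w [_ Uw]] := U P (pb_1 Q ∘ m) (pb_2 Q ∘ m) (comp_cong (pb_comm Q) m).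
    exists n; split=> //.
    rewrite -(Uw (n ∘ m)) ?(Uw (idm P)) ?comp_idr //.
    by rewrite -!comp_assoc !(comp_cong1 mn) comp_idl.
Qed.

Section Comparison.
Variables (X Y U W : C) (f : Hom X Y) (g : Hom U W) (a : Hom X U) (b : Hom Y W).
Hypothesis e : g ∘ a = b ∘ f.
Variable A : Pt Y.

Let m := pt_map (beck_chevalley R Po e A).
Let q := po_1 (push_po Po a (pull_ob R f A)).

(** Precomposed with the pushout coprojection [q], the canonical comparison has
    the two components below; they identify it with the map induced by
    [X *_Y A -> U *_W B]. *)
Lemma beck_chevalley_1 : pb_1 (pull_pb R g (push_ob Po b A)) ∘ m ∘ q = a ∘ pb_1 (pull_pb R f A).
Proof.
  have -> : pb_1 (pull_pb R g (push_ob Po b A)) ∘ m = pt_epi (push_ob Po a (pull_ob R f A)).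
    exact: (pt_map_epi (beck_chevalley R Po e A)).
  exact: po_desc_1.
Qed.

Lemma beck_chevalley_2 :
  pb_2 (pull_pb R g (push_ob Po b A)) ∘ m ∘ q = po_1 (push_po Po b A) ∘ pb_2 (pull_pb R f A).
Proof.
  have push_po1 (D E : Point X) (h : PointHom D E) :
      pt_map (push_map Po a h) ∘ po_1 (push_po Po a D) = po_1 (push_po Po a E) ∘ pt_map h.
    exact: po_desc_1.
  pose V := push_ob Po b A; pose V' := pull_ob R g V.
  pose s := pull_square_app R e V; pose n := pull_map R f (push_unit_app R Po b A).
  have counit_po1 : pt_map (push_counit_app R Po a V') ∘ po_1 (push_po Po a (pull_ob R a V'))
      = pb_2 (pull_pb R a V').
    exact: po_desc_1.
  have square2 : pb_2 (pull_pb R a V') ∘ pt_map s = pb_lift (pull_pb R g V) (pull_square_eq1 R e V).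
    exact: pb_lift_2.
  have unit2 : pb_2 (pull_pb R b V) ∘ pt_map (push_unit_app R Po b A) = po_1 (push_po Po b A).
    exact: pb_lift_2.
  have pull2 : pb_2 (pull_pb R f (pull_ob R b V)) ∘ pt_map n
      = pt_map (push_unit_app R Po b A) ∘ pb_2 (pull_pb R f A).
    exact: pb_lift_2.
  change (pb_2 (pull_pb R g V) ∘ (pt_map (push_counit_app R Po a V') ∘ pt_map (push_map Po a s)
    ∘ pt_map (push_map Po a n)) ∘ q = po_1 (push_po Po b A) ∘ pb_2 (pull_pb R f A)).
  rewrite -!comp_assoc push_po1 (comp_cong (push_po1 _ _ s)) (comp_cong1 counit_po1).
  rewrite (comp_cong1 square2) (comp_cong1 (pb_lift_2 _ _)) -comp_assoc pull2.
  by rewrite (comp_cong1 unit2).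
Qed.

(** The embedding of [X] is the section of [f^* A], so it is absorbed by the
    pushout defining [a_!]; that of [A] factors through [b_! A] because on the
    zero section it agrees with the embedding of [X]. *)
Lemma goursat_beck_chevalley (i : Hom Y X) (j : Hom W U) :
  IsGoursat R -> f ∘ i = idm Y -> IsRegularEpi a -> IsRegularEpi b -> a ∘ i = j ∘ b ->
  IsIso m.
Proof.
  move=> /goursatP G fi ra rb ai.
  apply/(@pullback_comparison _ _ _ _ _ _ (pull_pb R g (push_ob Po b A))).
  pose Z := pull_pb R f A.
  have E : f ∘ (i ∘ pt_epi A) = pt_epi A ∘ idm (pt_ob A).
    by rewrite (comp_cong1 fi) comp_idl comp_idr.
  pose lx := pt_sec (pull_ob R f A); pose la := pb_lift Z E.
  have la1 : pb_1 Z ∘ la = i ∘ pt_epi A := pb_lift_1 Z E.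
  have la2 : pb_2 Z ∘ la = idm (pt_ob A) := pb_lift_2 Z E.
  have las : la ∘ pt_sec A = lx ∘ i.
    apply: pb_ext.
      by rewrite (comp_cong la1) pt_split comp_idr (comp_cong1 (pb_lift_1 _ _)) comp_idl.
    by rewrite (comp_cong1 la2) comp_idl (comp_cong1 (pb_lift_2 _ _)) -comp_assoc fi comp_idr.
  have ql : q ∘ lx = po_2 (push_po Po a (pull_ob R f A)) ∘ a := po_comm _.
  have Eb : (q ∘ la) ∘ pt_sec A = (po_2 (push_po Po a (pull_ob R f A)) ∘ j) ∘ b.
    by rewrite -comp_assoc las (comp_cong ql) ai comp_assoc.
  exact: (quotient_pullback R G fi (pb_lift_1 _ _) la1 la2 e (po_desc_1 (push_po Po b A) _)
    ai ra (pushout_regular_epi _ rb) (pushout_regular_epi _ ra)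
    beck_chevalley_1 beck_chevalley_2 ql (eq_sym (po_desc_1 (push_po Po b A) Eb))).
Qed.
End Comparison.

(** For the square formed by [A], its pushout along [b] and their structure
    maps to [Y] and [W], the comparison at [A] is between a quotient of the
    kernel pair of [A -> Y] and the kernel pair of [b_! A -> W]. *)
Lemma beck_chevalley_lifting (Y W : C) (b : Hom Y W) (A : Pt Y) :
  IsRegularEpi b ->
  IsNatIso (beck_chevalley R Po (eq_sym (push_unit_eq Po b A))) -> LiftsKernelPair Po b A.
Proof.
  move=> rb /(_ A) /pt_iso /pullback_comparison PB.
  apply: (lifts_kernel_pair_of_pullback R (pb_comm (pull_pb R (pt_epi A) A)) _ PB).
  - exact: (pushout_regular_epi (push_po Po _ (pull_ob R (pt_epi A) A)) (pushout_regular_epi _ rb)).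
  - exact: beck_chevalley_1.
  - exact: beck_chevalley_2.
Qed.
End BeckChevalley.

Theorem theorem1p4 (C : Category) (R : Regular C) (Po : PushoutsAlongSplitMonos C) :
  let i := IsGoursat R in
  let ii := forall (Y W : C) (b : Hom Y W), IsRegularEpi b ->
    PreservesBinaryProducts (push Po b) in
  let iii := forall (X Y U W : C)
      (f : Hom X Y) (i : Hom Y X) (g : Hom U W) (j : Hom W U)
      (a : Hom X U) (b : Hom Y W),
    f ∘ i = idm Y -> g ∘ j = idm W ->
    IsRegularEpi a -> IsRegularEpi b ->
    forall e : g ∘ a = b ∘ f, a ∘ i = j ∘ b ->
    IsNatIso (beck_chevalley R Po e) in
  (i <-> ii) /\ (ii <-> iii) /\ (i <-> iii).
Proof.
  move=> i ii iii.
  have i_ii : i -> ii by move=> G Y W b rb; exact: (goursat_push_products G rb).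
  have i_iii : i -> iii.
    move=> G X Y U W f s g j a b fs _ ra rb e as_ A; apply/pt_iso.
    exact: (goursat_beck_chevalley Po e A G fs ra rb as_).
  have ii_i : ii -> i.
    move=> H; apply: (@goursat_of_lifting C R Po) => Y W b A rb.
    exact: (push_products_lifting R rb (H _ _ b rb)).
  have iii_i : iii -> i.
    move=> H; apply: (@goursat_of_lifting C R Po) => Y W b A rb.
    apply: (@beck_chevalley_lifting C R Po Y W b A rb).
    apply: H; [exact: pt_split | exact: (pt_split (push_ob Po b A)) | | exact: rb | exact: po_comm].
    exact: pushout_regular_epi.
  split; [split=> // | split; split=> // h].
  - exact: i_iii (ii_i h).
  - exact: i_ii (iii_i h).
Qed.
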